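(* Let $\mathcal{I}$ be a nontrivial admissible ideal of subsets of $\mathbb{N}$. The collection $$\mathfrak{T}_{\mathcal{I}}=\{A\subset\mathbb{R}: A\text{ is Lebesgue measurable and } \mathcal{I}\text{-}d_-(x,A)=1\text{ for all }x\in A\}$$ is a topology on $\mathbb{R}$.
   Context: $m$ denotes Lebesgue measure on $\mathbb{R}$. An ideal $\mathcal{I}$ of subsets of $\mathbb{N}=\{1,2,\dots\}$ is a nonempty family closed under finite unions and under subsets; it is nontrivial if $\mathcal{I}\neq\{\emptyset\}$ and $\mathbb{N}\notin\mathcal{I}$, and admissible if it contains all singletons. $\mathcal{F}(\mathcal{I})=\{M\subset\mathbb{N}:\mathbb{N}\setminus M\in\mathcal{I}\}$. For a bounded real sequence $x=(x_n)$: $\mathcal{I}\text{-}\liminf x=\inf\{a\in\mathbb{R}:\{k:x_k<a\}\notin\mathcal{I}\}$. Let $E\subset\mathbb{R}$ be Lebesgue measurable and $p\in\mathbb{R}$. Consider sequences $(J_n)_{n\in\mathbb{N}}$ of closed intervals with $p\in J_n$ for all $n$ and $\{n\in\mathbb{N}:0<m(J_n)<\frac1n\}\in\mathcal{F}(\mathcal{I})$. For such a sequence put $x_n=\frac{m(J_n\cap E)}{m(J_n)}$ (with $x_n:=0$ if $m(J_n)\in\{0,\infty\}$; such $n$ form a set in $\mathcal{I}$ and do not matter). The lower $\mathcal{I}$-density $\mathcal{I}\text{-}d_-(p,E)$ is the infimum of $\mathcal{I}\text{-}\liminf x_n$ over all such sequences $(J_n)$. *)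

(* Defs.v *)
From HB Require Import structures.
From mathcomp Require Import all_boot all_order all_algebra.
From mathcomp Require Import all_classical all_reals all_analysis.

Set Implicit Arguments.
Unset Strict Implicit.
Unset Printing Implicit Defensive.
Import Order.TTheory GRing.Theory Num.Theory.
Import numFieldNormedType.Exports.
Local Open Scope classical_set_scope.
Local Open Scope ring_scope.

Definition posnat := {n : nat | (0 < n)%N}.

Section Ideals.
Context {T : Type}.
Implicit Types (I : set_system T) (A B M : set T).

Definition set_ideal I :=
  [/\ I !=set0, setU_closed I & forall A B, A `<=` B -> I B -> I A].

Definition nontrivial_ideal I := I <> [set set0] /\ ~ I [set: T].

Definition admissible_ideal I := forall n : T, I [set n].

Definition ideal_filter I : set_system T := [set M | I (~` M)].

End Ideals.

Section IDensity.
Context {R : realType}.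
Implicit Types (I : set_system posnat) (E : set R) (p : R).

(* Only meaningful for bounded [x] and [~ I setT]: the set below is then
   nonempty and bounded below. *)
Definition ideal_liminf I (x : posnat -> R) : R :=
  inf [set a : R | ~ I [set k | x k < a]].

(* The library's [measurable] on [measurableTypeR R] is Borel measurability;
   Lebesgue measurability is Caratheodory measurability for the Lebesgue outer
   measure, i.e. membership in the domain of [completed_lebesgue_measure]. *)
Definition lebesgue_measurable : set_system R :=
  ((wlength (@idfun R))^*)%mu.-cara.-measurable.

Definition leb (A : set R) : \bar R := completed_lebesgue_measure A.

(* The intervals may be degenerate or unbounded. *)
Definition shrinking_intervals I p (J : posnat -> set R) :=
  (forall n, [/\ is_interval (J n), closed (J n) & J n p]) /\
  ideal_filter I
    [set n | (0 < leb (J n))%E /\ (leb (J n) < (((val n)%:R)^-1)%:E)%E].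

(* Equal to 0 when [leb J] is 0 or +oo, since then [fine (leb J) = 0] and
   [0^-1 = 0]. *)
Definition density_ratio E (J : set R) : R :=
  fine (leb (J `&` E)) / fine (leb J).

Definition lower_ideal_density I p E : R :=
  inf [set ideal_liminf I (fun n => density_ratio E (J n))
      | J in shrinking_intervals I p].

Definition ideal_density_opens I : set_system R :=
  [set A | lebesgue_measurable A /\
           forall x, A x -> lower_ideal_density I x A = 1].

End IDensity.

Definition is_topology (X : Type) (op : set_system X) :=
  [/\ op set0, op [set: X], setI_closed op &
      forall F : set_system X, F `<=` op -> op (\bigcup_(A in F) A)].

(* Main.v *)
Require Import Defs.
From mathcomp Require Import all_boot all_order all_algebra.
From mathcomp Require Import all_classical all_reals all_analysis.
From mathcomp Require Import measurable_realfun lra.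

(** The ideal plays no geometric role: lower ideal density [1] at [p] is
    ordinary density [1] at [p] with respect to closed intervals containing
    [p], so the family in question is the classical density topology.

    - If ordinary density fails, for some [e > 0] there are arbitrarily short
      closed intervals around [p] on which the ratio is below [1 - e]. Choosing
      one shorter than [1 / n] for each [n] gives an admissible sequence whose
      ratio is below [1 - e] at all indices, and the set of all indices is not
      in the ideal. Conversely, if the ratio is at least [1 - e] on all
      intervals shorter than [d], then in any admissible sequence it can drop
      below [1 - e] only at indices [n <= 1 / d], finitely many, or at indices
      where [J n] has the wrong length; both sets are in the ideal. This is
      [lower_ideal_density_eq1_density_point].

    - Density is stated as smallness of the outer measure of [J `\` A]. In this
      form it passes to supersets by monotonicity and to finite intersections
      by subadditivity.

    - The one delicate point is that an arbitrary, possibly uncountable, union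
      [U] of density open sets is measurable. Each point of [U] is a density
      point of [U] in the outer measure sense, and this already forces
      measurability ([density_points_measurable]). Indeed, let [W] be a Borel
      set of finite measure and [H] a Borel hull of [W `\` U], with the same outer
      measure as [W `\` U] inside every Borel set ([measurable_hull]). Around a
      point of [U], small intervals meet [W `\` U] in a set of small relative
      outer measure, hence meet [H] in a set of small relative measure. By
      Lebesgue's density theorem [H] has density [1] at almost all of its own
      points, so [U `&` H] is negligible, and [U `&` W] differs from the Borel
      set [W `\` H] by a negligible set. *)

Set Implicit Arguments.
Unset Strict Implicit.
Unset Printing Implicit Defensive.
Import Order.TTheory GRing.Theory Num.Theory.
Import numFieldNormedType.Exports.
Local Open Scope classical_set_scope.
Local Open Scope ring_scope.

(** * Lebesgue outer measure and measurable hulls *)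

Section density_points.
Context {R : realType}.
Implicit Types (A D E J X : set R) (p : R).

(* [leb] is convertible to this outer measure, so it is monotone and subadditive
   on all sets, measurable or not. *)
Notation lambda := ((wlength (@idfun R))^*)%mu.

Lemma leb_ge0 A : (0 <= leb A)%E.
Proof. exact: (outer_measure_ge0 lambda). Qed.

Lemma le_leb A D : A `<=` D -> (leb A <= leb D)%E.
Proof. exact: (le_outer_measure lambda). Qed.

Lemma leb_setU A D : (leb (A `|` D) <= leb A + leb D)%E.
Proof. exact: (outer_measureU2 lambda). Qed.

Lemma leb_setID A X : lebesgue_measurable A ->
  leb X = (leb (X `&` A) + leb (X `\` A))%E.
Proof. by move=> mA; rewrite setDE; exact: mA. Qed.

Lemma borel_lebesgue_measurable (A : set (measurableTypeR R)) :
  measurable A -> lebesgue_measurable A.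
Proof. exact: sub_caratheodory. Qed.

Lemma negligible_lebesgue_measurable (N : set R) :
  (@lebesgue_measure R).-negligible N -> lebesgue_measurable N.
Proof.
move=> [B [mB B0 NB]]; apply: negligible_sub_caratheodory.
by exists B; split => //; exact: borel_lebesgue_measurable.
Qed.

(** A measurable superset [H] of the same finite measure works: splitting both
    measures along [D] gives two inequalities whose sums agree and are finite,
    so both are equalities. *)
Lemma measurable_hull X : (leb X < +oo)%E ->
  exists2 H : set (measurableTypeR R), measurable H &
    X `<=` H /\ forall D : set (measurableTypeR R), measurable D ->
      leb (H `&` D) = leb (X `&` D).
Proof.
move=> Xoo; have [G [oG XH HX]] := outer_measure_Gdelta X.
set H := \bigcap_i G i in XH HX.
exists H; first by apply: bigcapT_measurable => i; exact: open_measurable.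
split=> // D mD; have mD' := borel_lebesgue_measurable mD.
have hX : leb H = leb X by exact: HX.
have leI : (leb (X `&` D) <= leb (H `&` D))%E by apply: le_leb; exact: setSI.
have leD : (leb (X `\` D) <= leb (H `\` D))%E by apply: le_leb; exact: setSD.
move: hX Xoo leI leD; rewrite (leb_setID X mD') (leb_setID H mD').
move: (leb_ge0 (X `&` D)) (leb_ge0 (X `\` D)).
move: (leb_ge0 (H `&` D)) (leb_ge0 (H `\` D)).
move: (leb (X `&` D)) (leb (X `\` D)) (leb (H `&` D)) (leb (H `\` D)).
move=> [a| |] [b| |] [c| |] [d| |] //=; rewrite ?lee_fin -?EFinD.
move=> _ _ _ _ [] cd _ ac bd; congr (_%:E); lra.
Qed.

(** * Density points for the outer measure *)

(** The condition bears on [J `\` A] and not on [J `&` A]: for the outer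
    measure of a non-measurable [A] the two are not complementary, and only the
    former is subadditive under intersections of the sets [A] and makes
    [density_points_measurable] true. *)
Definition density_point A p := forall e : R, 0 < e -> exists2 d : R, 0 < d &
  forall J, is_interval J -> closed J -> J p ->
    (0 < leb J)%E -> (leb J < d%:E)%E -> (leb (J `\` A) <= e%:E * leb J)%E.

Lemma density_pointS A E p : A `<=` E -> density_point A p -> density_point E p.
Proof.
move=> AE dA e e0; have [d d0 dJ] := dA e e0; exists d => // J iJ cJ Jp J0 Jd.
by apply: le_trans (dJ J iJ cJ Jp J0 Jd); apply: le_leb; exact: setDS.
Qed.

Lemma density_pointT p : density_point setT p.
Proof.
move=> e e0; exists 1 => // J _ _ _ J0 _.
by rewrite setDT [leb set0]measure0 mule_ge0// ltW.
Qed.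

Lemma density_pointI A E p :
  density_point A p -> density_point E p -> density_point (A `&` E) p.
Proof.
move=> dA dE e e0; have e20 : 0 < e / 2 by rewrite divr_gt0.
have [a a0 aJ] := dA _ e20; have [b b0 bJ] := dE _ e20.
exists (Num.min a b); first by rewrite lt_min a0.
move=> J iJ cJ Jp J0; rewrite EFin_min lt_min => /andP[Ja Jb].
rewrite setDIr; apply: le_trans (leb_setU _ _) _.
rewrite [X in X%:E](splitr e) EFinD ge0_muleDl ?lee_fin ?(ltW e20)//.
by apply: leeD; [exact: aJ|exact: bJ].
Qed.

Lemma leb_itvcc (p r : R) : 0 < r -> leb `[p - r, p + r]%classic = (r *+ 2)%:E.
Proof.
move=> r0; rewrite -closed_ball_itv//.
exact: (lebesgue_measure_closed_ball p (ltW r0)).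
Qed.

(** With [H] a hull of [W `\` U], the set [U `&` W] is the Borel set [W `\` H]
    together with [U `&` W `&` H]. The latter is negligible because no point of
    it can be a density point of [H]. *)
Lemma density_points_measurable_bounded U (W : set (measurableTypeR R)) :
  (forall p, U p -> density_point U p) ->
  measurable W -> (leb W < +oo)%E -> lebesgue_measurable (U `&` W).
Proof.
move=> dU mW Woo.
have [|H mH [XH HE]] := @measurable_hull (W `\` U).
  by apply: le_lt_trans Woo; apply: le_leb; exact: subDsetl.
have -> : U `&` W = (W `\` H) `|` (U `&` W `&` H).
  apply/seteqP; split=> [x [Ux Wx]|x [[Wx nHx]|[]//]].
    by have [Hx|nHx] := pselect (H x); [right|left].
  by split=> //; apply: contrapT => nUx; apply/nHx/XH.
apply: (@measurableU _ (caratheodory_type _)).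
  by apply: borel_lebesgue_measurable; exact: measurableD.
apply: negligible_lebesgue_measurable.
apply: negligibleS (lebesgue_density mH) => p [[Up Wp] Hp]/= cv.
have half_gt0 : 0 < 2^-1 :> R by rewrite invr_gt0.
have [d d0 dJ] := dU p Up 2^-1 half_gt0.
have {}cv : \forall r \near 0^'+,
    ((2^-1)%:E < lebesgue_measure (H `&` ball p r) *
                 (lebesgue_measure (ball p r))^-1)%E.
  apply: (cv [set y : \bar R | ((2^-1)%:E < y)%E]); apply: open_nbhs_nbhs.
  split; first exact: open_ereal_gt_ereal.
  by rewrite /= indicE mem_set// lte_fin invf_lt1// ltr1n.
(* A single small radius [r] suffices for the contradiction: [H] fills more
   than half of [ball p r], whereas [J `\` U] is at most half of [J]. *)
suff : \forall r \near (0:R)^'+, False by move=> /filter_ex[].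
near=> r.
have r0 : 0 < r by [].
have rd : r < d / 2.
  by near: r; apply: nbhs_right_lt; rewrite divr_gt0.
have : ((2^-1)%:E < lebesgue_measure (H `&` ball p r) *
                 (lebesgue_measure (ball p r))^-1)%E by near: r.
rewrite lebesgue_measure_ball ?(ltW r0)// inver mulrn_eq0/= gt_eqF//.
rewrite [lebesgue_measure _]HE; last exact: measurable_ball.
pose J := `[p - r, p + r]%classic.
have lJ : leb J = (r *+ 2)%:E by exact: leb_itvcc.
have : (leb (J `\` U) <= (2^-1)%:E * leb J)%E.
  apply: dJ; rewrite ?lJ ?lte_fin ?mulrn_wgt0//.
  - exact: interval_is_interval.
  - exact: interval_closed.
  - by rewrite /J/= in_itv/= lerBlDr lerDl (ltW r0).
  - by rewrite -mulr_natr -ltr_pdivlMr.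
have : (leb ((W `\` U) `&` ball p r) <= leb (J `\` U))%E.
  apply: le_leb => x [[_ nUx] prx]; split=> //.
  by rewrite /J -closed_ball_itv//; exact: subset_closure.
move=> /le_trans/[apply]; rewrite lJ -EFinM => le1 lt1.
have := lt_le_trans lt1 (lee_wpmul2r _ le1).
rewrite -EFinM lte_fin lee_fin invr_ge0 mulrn_wge0 ?(ltW r0)// => /(_ isT).
by rewrite mulfK ?ltxx// mulrn_eq0/= gt_eqF.
Unshelve. all: by end_near. Qed.

Lemma density_points_measurable U :
  (forall p, U p -> density_point U p) -> lebesgue_measurable U.
Proof.
move=> dU; rewrite -(setIT U) -bigcup_ballT setI_bigcupr.
apply: (@bigcupT_measurable _ (caratheodory_type _)) => n.
apply: density_points_measurable_bounded => //; first exact: measurable_ball.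
by rewrite [leb _]lebesgue_measure_ball// ltry.
Qed.


Lemma density_ratio_ge (e : R) A J : lebesgue_measurable A ->
    (0 < leb J)%E -> (leb J < +oo)%E ->
  (1 - e <= density_ratio A J) = (leb (J `\` A) <= e%:E * leb J)%E.
Proof.
move=> mA J0 Joo; rewrite /density_ratio.
move: J0 Joo (leb_ge0 (J `&` A)) (leb_ge0 (J `\` A)).
rewrite (leb_setID J mA).
move: (leb (J `&` A)) (leb (J `\` A)) => [a| |] [b| |] //=.
rewrite lte_fin -EFinM !lee_fin => ab0 _ _ _.
by rewrite ler_pdivlMr//; apply/idP/idP => ?; lra.
Qed.

Lemma density_ratio_ge0 A J : 0 <= density_ratio A J.
Proof. by rewrite divr_ge0// fine_ge0// leb_ge0. Qed.

Lemma density_ratio_le1 A J : density_ratio A J <= 1.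
Proof.
rewrite /density_ratio; move: (leb_ge0 (J `&` A)) (leb_ge0 J).
have : (leb (J `&` A) <= leb J)%E by apply: le_leb; exact: subIsetl.
move: (leb (J `&` A)) (leb J) => [a| |] [b| |] //=; rewrite ?invr0 ?mulr0//.
rewrite !lee_fin => ab a0; rewrite le_eqVlt => /predU1P[<-|b0].
  by rewrite invr0 mulr0.
by rewrite ler_pdivrMr// mul1r.
Qed.

End density_points.

(** * Ideal limit inferior of a sequence with values in [0, 1] *)

Section ideal_limits.
Context {R : realType} (I : set_system posnat).
Hypotheses (idealI : set_ideal I) (ntI : nontrivial_ideal I).
Implicit Types (x : posnat -> R) (c : R).

Lemma ideal_set0 : I set0.
Proof. by case: idealI => -[M IM] _ sub; exact: sub IM. Qed.

Lemma ideal_liminf_ge x c : (exists a, ~ I [set k | x k < a]) ->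
  I [set k | x k < c] -> c <= ideal_liminf I x.
Proof.
move=> ex Ic; apply: lb_le_inf => // a nIa; rewrite leNgt; apply/negP => ac.
apply: nIa; case: idealI => _ _; apply; last exact: Ic.
by move=> k /= /lt_trans; exact.
Qed.

Lemma ideal_liminf_le x c : (exists a, I [set k | x k < a]) ->
  ~ I [set k | x k < c] -> ideal_liminf I x <= c.
Proof.
move=> [b Ib] nIc; apply: ge_inf => //; exists b => a nIa.
rewrite leNgt; apply/negP => ab.
apply: nIa; case: idealI => _ _; apply; last exact: Ib.
by move=> k /= /lt_trans; exact.
Qed.

Section unit_valued.
Variable x : posnat -> R.
Hypotheses (x_ge0 : forall k, 0 <= x k) (x_le1 : forall k, x k <= 1).

Let below0 : I [set k | x k < 0].
Proof.
rewrite (_ : mkset _ = set0); first exact: ideal_set0.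
by apply/seteqP; split => // k /=; rewrite ltNge x_ge0.
Qed.

Let above1 c : 1 < c -> ~ I [set k | x k < c].
Proof.
move=> c1; rewrite (_ : mkset _ = setT); first by case: ntI.
by apply/seteqP; split => // k _ /=; exact: le_lt_trans c1.
Qed.

Lemma ideal_liminf_ge0 : 0 <= ideal_liminf I x.
Proof. by apply: ideal_liminf_ge => //; exists 2; apply: above1; lra. Qed.

Lemma ideal_liminf_le1 : ideal_liminf I x <= 1.
Proof.
apply/ler_addgt0Pr => e e0; apply: ideal_liminf_le; first by exists 0.
by apply: above1; lra.
Qed.

(** The maximal possible value [1] of the limit inferior is ideal convergence to
    [1]. *)
Lemma ideal_liminf_eq1 :
  ideal_liminf I x = 1 <-> forall e, 0 < e -> I [set k | x k < 1 - e].
Proof.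
split=> [x1 e e0|Ie].
  apply: contrapT => /(ideal_liminf_le (ex_intro _ 0 below0)).
  by rewrite x1; lra.
apply/eqP; rewrite eq_le ideal_liminf_le1/=; apply/ler_addgt0Pr => e e0.
rewrite -lerBlDr; apply: ideal_liminf_ge; last exact: Ie.
by exists 2; apply: above1; lra.
Qed.

End unit_valued.

Hypothesis admI : admissible_ideal I.

(** * Lower ideal density one is ordinary density one *)

Lemma ideal_initial_segment N : I [set k | (val k < N)%N].
Proof.
have [_ IU IS] := idealI.
elim: N => [|N IN].
  by apply: IS ideal_set0 => k.
have [->|N0] := eqVneq N 0%N.
  apply: IS ideal_set0 => -[k k0] /=; case: k k0 => //.
rewrite -lt0n in N0; pose n : posnat := exist _ N N0.
apply: IS (IU _ _ IN (admI n)) => k /=.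
rewrite ltnS leq_eqVlt => /predU1P[kN|]; [right|by left].
exact: val_inj.
Qed.

Implicit Types (A E : set R) (p : R).

Lemma shrinking_intervals_nonempty p : shrinking_intervals I p !=set0.
Proof.
(* Half-length [1 / (4 n)] gives length [1 / (2 n)], strictly below [1 / n]. *)
pose r (n : posnat) : R := (4 * (val n)%:R)^-1.
have n0 (n : posnat) : 0 < (val n)%:R :> R by rewrite ltr0n; exact: valP.
have r0 n : 0 < r n by rewrite invr_gt0 mulr_gt0.
exists (fun n => `[p - r n, p + r n]%classic); split => [n|].
  split; [exact: interval_is_interval|exact: interval_closed|].
  by rewrite /= in_itv/= lerBlDr lerDl (ltW (r0 n)).
rewrite /ideal_filter/= (_ : ~` _ = set0); first exact: ideal_set0.
apply/seteqP; split => // n; apply.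
rewrite /= leb_itvcc// !lte_fin mulrn_wgt0//; split=> //.
rewrite /r invfM.
have : 0 < (val n)%:R^-1 :> R by rewrite invr_gt0.
lra.
Qed.

(** All limits inferior in the defining infimum lie in [0, 1], so the infimum is
    [1] exactly when they all are; there being at least one admissible sequence
    excludes the conventional value of the infimum of the empty set. *)
Lemma lower_ideal_density_eq1 A p : lower_ideal_density I p A = 1 <->
  forall J, shrinking_intervals I p J ->
    ideal_liminf I (fun n => density_ratio A (J n)) = 1.
Proof.
have ge0 J : 0 <= ideal_liminf I (fun n => density_ratio A (J n)).
  apply: ideal_liminf_ge0 => k; first exact: density_ratio_ge0.
  exact: density_ratio_le1.
have le1 J : ideal_liminf I (fun n => density_ratio A (J n)) <= 1.
  apply: ideal_liminf_le1 => k; first exact: density_ratio_ge0.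
  exact: density_ratio_le1.
split=> [d1 J sJ|lim1].
  apply/eqP; rewrite eq_le le1/= -d1; apply: ge_inf; last by exists J.
  by exists 0 => _ [K _ <-]; exact: ge0.
rewrite /lower_ideal_density (_ : image _ _ = [set 1]) ?inf1//.
apply/seteqP; split => [_ [J sJ <-]|_ ->]; first exact: lim1.
by have [J sJ] := shrinking_intervals_nonempty p; exists J => //; exact: lim1.
Qed.

(** The left-to-right direction turns a failure of density into one bad interval
    shorter than [1 / n] for every [n], a sequence whose ratios stay below
    [1 - e] at every index. *)
Lemma lower_ideal_density_eq1_density_point A p : lebesgue_measurable A ->
  lower_ideal_density I p A = 1 <-> density_point A p.
Proof.
move=> mA; have [_ IU IS] := idealI.
have liminf1 J := @ideal_liminf_eq1 (fun n => density_ratio A (J n))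
  (fun k => density_ratio_ge0 A (J k)) (fun k => density_ratio_le1 A (J k)).
rewrite lower_ideal_density_eq1; split=> [lim1|dA J [J_itv J_small]].
  move=> e e0; apply: contrapT => no_d.
  have bad (n : posnat) : exists J : set R, [/\ is_interval J, closed J, J p &
      [/\ (0 < leb J)%E, (leb J < (((val n)%:R)^-1)%:E)%E &
          ~ (leb (J `\` A) <= e%:E * leb J)%E]].
    apply: contrapT => noJ; apply: no_d; exists ((val n)%:R)^-1.
      by rewrite invr_gt0 ltr0n; exact: valP.
    move=> J iJ cJ Jp J0 Jn; apply: contrapT => JA.
    by apply: noJ; exists J.
  have [J JP] := choice bad.
  have sJ : shrinking_intervals I p J.
    split=> [n|]; first by have [] := JP n.
    rewrite /ideal_filter/= (_ : ~` _ = set0); first exact: ideal_set0.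
    by apply/seteqP; split => // n; apply; have [_ _ _ []] := JP n.
  have := (liminf1 J).1 (lim1 _ sJ) e e0.
  rewrite (_ : mkset _ = setT); first by case: ntI.
  apply/seteqP; split=> // n _ /=; have [_ _ _ [J0 Jn JA]] := JP n.
  rewrite ltNge; apply/negP; rewrite density_ratio_ge//.
  exact: lt_trans Jn (ltry _).
apply/liminf1 => e e0; have [d d0 dJ] := dA e e0.
pose N := (Num.truncn d^-1).+1.
apply: IS (IU _ _ J_small (ideal_initial_segment N)) => n /= small.
have [nN|Nn] := ltnP (val n) N; [by right|left].
move=> [J0 Jn]; move: small; apply/negP; rewrite -leNgt.
rewrite density_ratio_ge//; last exact: lt_trans Jn (ltry _).
have [iJ cJ Jp] := J_itv n; apply: dJ => //; apply: lt_trans Jn _.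
rewrite lte_fin invf_plt ?posrE//; last by rewrite ltr0n; exact: valP.
by apply: lt_le_trans (truncnS_gt _) _; rewrite ler_nat.
Qed.

Lemma ideal_density_opensE : @ideal_density_opens R I =
  [set A | lebesgue_measurable A /\ forall p, A p -> density_point A p].
Proof.
by apply/seteqP; split => A [mA dA]; split=> // p Ap;
  apply/lower_ideal_density_eq1_density_point => //; exact: dA.
Qed.

End ideal_limits.

(** * The density topology *)

Theorem theorem4p2 (R : realType) (I : set_system posnat)
    (idealI : set_ideal I) (ntI : nontrivial_ideal I)
    (admI : admissible_ideal I) :
  is_topology (@ideal_density_opens R I).
Proof.
rewrite ideal_density_opensE//; split=> [||A E [mA dA] [mE dE]|F opF].
- by split=> //; exact: (@measurable0 _ (caratheodory_type _)).
- split=> [|p _]; last exact: density_pointT.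
  exact: (@measurableT _ (caratheodory_type _)).
- split=> [|p [Ap Ep]]; first exact: (@measurableI _ (caratheodory_type _)).
  by apply: density_pointI; [exact: dA|exact: dE].
- have dF p : (\bigcup_(A in F) A) p -> density_point (\bigcup_(A in F) A) p.
    move=> [A FA Ap]; have [_ dA] := opF A FA.
    by apply: density_pointS (dA p Ap); exact: bigcup_sup.
  by split=> //; exact: density_points_measurable.
Qed.
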